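(* Let $X\subseteq\mathbb{E}^n$ be a finite configuration with diameter $b$. (1) If the box-width of $X$ is $a>0$ and $P$ is a configuration with $t_1$ points and diameter at most $a(t_1-2)$, then $$\mathbb{E}^n\overset{\lceil b/a\rceil+1}{\nrightarrow}(X;P)_{\mathrm{GR}}.$$ (2) If $X$ has affine dimension $m<n$, let $g_X$ be the minimal number among the diameters of all possible projections of $X$ onto some $(n-m+1)$-dimensional subspaces. Set $h:=\frac{g_X}{\sqrt{n-m+1}}$. If $P$ has more than $(t_2+1)^{n-m+1}$ points and the diameter of $P$ is at most $ht_2$, then $$\mathbb{E}^n\overset{(\lceil b/h\rceil+1)^{n-m+1}}{\nrightarrow}(X;P)_{\mathrm{GR}}.$$
   Context: $\mathbb{E}^n$ denotes $n$-dimensional Euclidean space. An $r$-coloring of $\mathbb{E}^n$ is an assignment to each point of one of $r$ colors. A set of points is monochromatic if all its points have the same color, and rainbow if its points have pairwise distinct colors. $\mathbb{E}^n\overset{r}{\nrightarrow}(K_1;K_2)_{\mathrm{GR}}$ means that there exists an $r$-coloring of $\mathbb{E}^n$ with neither a monochromatic configuration congruent to $K_1$ nor a rainbow configuration congruent to $K_2$. The diameter of a finite configuration is the largest distance between any two of its points. The box-width of $X\subseteq\mathbb{E}^n$ is the smallest non-negative real number $a$ such that $X$ can be embedded (by a congruent copy) into $[0,a]\times\mathbb{E}^{n-1}$. The affine dimension of an affine space is the dimension of the vector space of its translations; the affine dimension of $X$ is that of its affine hull. In (2), the minimum defining $g_X$ is taken over all $(n-m+1)$-dimensional subspaces of $\mathbb{E}^n$,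 the projections being orthogonal projections. *)

(* Defs.v *)
From HB Require Import structures.
From mathcomp Require Import all_boot all_order all_algebra.
From mathcomp Require Import finmap.
From mathcomp Require Import boolp classical_sets reals.

Set Implicit Arguments.
Unset Strict Implicit.
Unset Printing Implicit Defensive.

Import Order.TTheory GRing.Theory Num.Theory.

Local Open Scope ring_scope.

(* Euclidean n-space is 'rV[R]_n with the dot product; the norm which           *)
(* MathComp-Analysis puts on matrices is the sup norm, hence is not used here.  *)
Definition dot (R : realType) (n : nat) (x y : 'rV[R]_n) : R :=
  \sum_(i < n) x 0 i * y 0 i.

Definition edist (R : realType) (n : nat) (x y : 'rV[R]_n) : R :=
  Num.sqrt (dot (x - y) (x - y)).

Definition diam (R : realType) (n : nat) (X : {fset 'rV[R]_n}) : R :=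
  \big[Num.max/0]_(x <- X) \big[Num.max/0]_(y <- X) edist x y.

Definition isometry (R : realType) (n : nat) (f : 'rV[R]_n -> 'rV[R]_n) : Prop :=
  forall x y, edist (f x) (f y) = edist x y.

Definition congruent (R : realType) (n : nat) (X Y : {fset 'rV[R]_n}) : Prop :=
  exists2 f : 'rV[R]_n -> 'rV[R]_n, isometry f & Y = [fset f x | x in X]%fset.

Definition monochromatic (R : realType) (n r : nat) (c : 'rV[R]_n -> 'I_r)
    (X : {fset 'rV[R]_n}) : Prop :=
  forall x y, x \in X -> y \in X -> c x = c y.

Definition rainbow (R : realType) (n r : nat) (c : 'rV[R]_n -> 'I_r)
    (X : {fset 'rV[R]_n}) : Prop :=
  forall x y, x \in X -> y \in X -> x != y -> c x != c y.

(* The negated arrow "E^n -/->^r (K1; K2)_GR". *)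
Definition GR_not_arrow (R : realType) (n r : nat) (K1 K2 : {fset 'rV[R]_n}) :
    Prop :=
  exists c : 'rV[R]_n -> 'I_r,
    (forall Y, congruent K1 Y -> ~ monochromatic c Y) /\
    (forall Y, congruent K2 Y -> ~ rainbow c Y).

(* Y lies in [0, a] x E^(n-1); the quantification over i picks out the first    *)
(* coordinate without requiring n to be syntactically a successor.              *)
Definition in_box (R : realType) (n : nat) (a : R) (Y : {fset 'rV[R]_n}) : Prop :=
  forall (y : 'rV[R]_n) (i : 'I_n),
    y \in Y -> i = 0%N :> nat -> 0 <= y 0 i <= a.

(* This infimum, like that of [min_proj_diam] for 0 < k <= n, is attained (by   *)
(* compactness of the orthogonal group), so it is the smallest element of the   *)
(* set. If that set has a least element x, then [inf_least] below gives         *)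
(* box_width X = x.                                                             *)
Definition box_width (R : realType) (n : nat) (X : {fset 'rV[R]_n}) : R :=
  inf [set a : R | 0 <= a /\ exists2 Y, congruent X Y & in_box a Y]%classic.

Definition affine_hull (R : realType) (n : nat) (X : {fset 'rV[R]_n})
    (p : 'rV[R]_n) : Prop :=
  exists2 w : 'rV[R]_n -> R,
    \sum_(x <- X) w x = 1 & p = \sum_(x <- X) w x *: x.

(* V is the vector space of the translations that preserve the affine hull of   *)
(* X. For empty X this gives m = n.                                             *)
Definition has_affine_dim (R : realType) (n : nat) (X : {fset 'rV[R]_n})
    (m : nat) : Prop :=
  exists2 V : {vspace 'rV[R]_n},
    forall v, v \in V <-> (forall p, affine_hull X (p + v) <-> affine_hull X p)
    & \dim V = m.

(* [projv] projects along a complement that need not be orthogonal.             *)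
Definition orth_proj (R : realType) (n : nat) (V : {vspace 'rV[R]_n})
    (p : 'rV[R]_n -> 'rV[R]_n) : Prop :=
  forall x, p x \in V /\ forall v, v \in V -> dot (x - p x) v = 0.

Definition min_proj_diam (R : realType) (n : nat) (X : {fset 'rV[R]_n})
    (k : nat) : R :=
  inf [set d : R | exists (V : {vspace 'rV[R]_n}) (p : 'rV[R]_n -> 'rV[R]_n),
    [/\ \dim V = k, orth_proj V p & d = diam [fset p x | x in X]%fset]]%classic.

Lemma inf_least (R : realType) (A : set R) (x : R) :
  A x -> lbound A x -> inf A = x.
Proof.
move=> Ax lbx; apply/le_anti/andP; split.
  by apply: ge_inf => //; exists x.
by apply: lb_le_inf => //; exists x.
Qed.

(* Main.v *)
Require Import Defs.
From HB Require Import structures.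
From mathcomp Require Import all_boot all_order all_algebra.
From mathcomp Require Import finmap.
From mathcomp Require Import boolp classical_sets reals.
From mathcomp Require Import lra.

(** Both parts use one periodic grid colouring. Let [u] be [k] real coordinates
    on space that are 1-Lipschitz for the Euclidean distance, cut each of them
    into half-open intervals of length [h], and colour a point by the indices of
    its [k] intervals taken modulo [N + 1], where [N] is the ceiling of
    [diam X / h].

    A copy of [X] has diameter at most [h * N], so two of its points have
    interval indices that differ by at most [N]; if moreover the copy is
    monochromatic, these indices are congruent modulo [N + 1], hence equal. The
    whole copy then lies in one half-open cell, and all its coordinate
    differences are strictly less than [h]. In the same way, the indices in a
    copy of [P] differ by at most [t] when [diam P <= h * t]. Their residues
    modulo [t + 1] thus determine the cell, which leaves at most
    [(t + 1) ^ k] cells; if [P] has more points, two of them share a cell, so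
    they share a colour. This is [grid_not_arrow]. It remains to see that
    no copy of [X] fits into a half-open cell.

    For the box-width [a], take [k = 1], [h = a] and the first coordinate: a copy
    in a half-open slab of width [a] would, being finite, fit after a translation
    into a box of width less than [a] ([box_width_le_spread]). The count is right
    since [t = t1 - 2] gives [t1 - 1] slabs for [t1] points.

    For projections, take the first [k = n - m + 1] coordinates. A copy of [X] in
    a half-open cube of side [h] would project onto the first [k] axes with
    diameter less than [h * sqrt k = g]. An isometry is an orthogonal map followed
    by a translation ([isometry_affine]), so that projection is congruent to the
    projection of [X] itself onto the [k]-dimensional subspace that the
    orthogonal map carries to the span of these axes, and the latter has diameter
    at least [g] ([min_proj_diam_le_spread]). *)

Set Implicit Arguments.
Unset Strict Implicit.
Unset Printing Implicit Defensive.

Import Order.TTheory GRing.Theory Num.Theory.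

Local Open Scope ring_scope.

(** * Finite sets *)

Lemma fset_inj_card (T : choiceType) (F : finType) (G : T -> F)
    (Y : {fset T}) :
  {in Y &, injective G} -> (#|` Y| <= #|F|)%N.
Proof.
move=> Ginj; have uG : uniq (map G Y) by rewrite map_inj_in_uniq ?fset_uniq.
by rewrite -(size_map G) -(card_uniqP uG) max_card.
Qed.

Lemma fset_argmin (d : Order.disp_t) (T : choiceType) (U : orderType d)
    (F : T -> U) (Y : {fset T}) (y : T) :
  y \in Y -> exists2 y0, y0 \in Y & forall z, z \in Y -> (F y0 <= F z)%O.
Proof.
move=> yY.
case: (arg_minP (P := predT) (fun z : Y => F (val z)) (isT : predT [` yY]%fset)).
move=> z0 _ z0min; exists (val z0); first exact: valP.
by move=> z zY; exact: (z0min [` zY]%fset).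
Qed.

(** * Distances, diameters and isometries *)

Section Metric.
Variables (R : realType) (n : nat).
Implicit Types (x y : 'rV[R]_n) (X Y : {fset 'rV[R]_n}).

Lemma dotE x y : dot x y = (x *m y^T) 0 0.
Proof. by rewrite mxE; apply: eq_bigr => i _; rewrite mxE. Qed.

Lemma dotBB x y : dot (x - y) (x - y) = dot x x + dot y y - 2 * dot x y.
Proof.
rewrite /dot mulr_sumr -big_split -sumrB; apply: eq_bigr => i _ /=.
by rewrite !mxE; lra.
Qed.

Lemma dotxx_ge0 x : 0 <= dot x x.
Proof. by apply: sumr_ge0 => i _; rewrite -expr2 sqr_ge0. Qed.

Lemma coord_le_edist x y i : `|x 0 i - y 0 i| <= edist x y.
Proof.
rewrite -sqrtr_sqr /edist ler_wsqrtr // /dot (bigD1 i) //= !mxE -expr2 lerDl.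
by apply: sumr_ge0 => j _; rewrite -expr2 sqr_ge0.
Qed.

Lemma edist_le_diam X x y : x \in X -> y \in X -> edist x y <= diam X.
Proof.
move=> xX yX; apply: bigmax_sup_seq xX _ _ => //.
exact: le_bigmax_seq.
Qed.

Lemma diam_lt X (d : R) :
  0 < d -> (forall x y, x \in X -> y \in X -> edist x y < d) -> diam X < d.
Proof.
move=> d0 Xd; rewrite /diam big_seq; apply: bigmax_lt => // x xX.
by rewrite big_seq; apply: bigmax_lt => // y; apply: Xd.
Qed.

Lemma diam_ge0 X : 0 <= diam X.
Proof. exact: bigmax_ge_id. Qed.

Lemma diam_le0_card X : diam X <= 0 -> (#|` X| <= 1)%N.
Proof.
move=> X0; apply: (@leq_trans #|{: unit}|); last by rewrite card_unit.
apply: (@fset_inj_card _ _ (fun=> tt)) => x y xX yX _.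
apply/rowP => i; apply/eqP; rewrite -subr_eq0 -normr_le0.
apply: le_trans X0; apply: le_trans (edist_le_diam xX yX).
exact: coord_le_edist.
Qed.

Lemma isometry_inj (f : 'rV[R]_n -> 'rV[R]_n) : Defs.isometry f -> injective f.
Proof.
move=> fiso x y fxy.
have d0 : edist x y = 0 by rewrite -fiso fxy /edist subrr /dot big1 ?sqrtr0 //
  => i _; rewrite mxE mul0r.
apply/rowP => i; apply/eqP; rewrite -subr_eq0 -normr_eq0 eq_le normr_ge0 andbT.
by rewrite -d0 coord_le_edist.
Qed.

Lemma congruent_edist_le X Y y z :
  congruent X Y -> y \in Y -> z \in Y -> edist y z <= diam X.
Proof.
move=> [f fiso ->] /imfsetP[x /= xX ->] /imfsetP[x' /= x'X ->].
by rewrite fiso edist_le_diam.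
Qed.

Lemma congruent_card X Y : congruent X Y -> #|` Y| = #|` X|.
Proof.
by move=> [f fiso ->]; rewrite card_imfset //; exact: isometry_inj.
Qed.

(** Up to the translation by [f 0], an isometry preserves norms and distances,
    hence dot products by polarization. The images of the standard basis vectors
    are therefore the rows of an orthogonal matrix [Q]; an image is determined by
    its dot products with these rows, which gives linearity without computing
    any [f (x + y)]. *)
Lemma isometry_affine (f : 'rV[R]_n -> 'rV[R]_n) : Defs.isometry f ->
  exists2 Q : 'M[R]_n, Q *m Q^T = 1%:M & forall x, f x = f 0 + x *m Q.
Proof.
move=> fiso; pose g x := f x - f 0.
have sq x y : dot (f x - f y) (f x - f y) = dot (x - y) (x - y).
  by apply/eqP; rewrite -eqr_sqrt ?dotxx_ge0 //; apply/eqP/fiso.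
have gg x y : dot (g x) (g y) = dot x y.
  have := sq x y; have := sq x 0; have := sq y 0.
  have -> : f x - f y = g x - g y by rewrite /g opprB addrA subrK.
  by rewrite !subr0 -/(g x) -/(g y) !dotBB; lra.
pose Q := \matrix_(i < n) g (delta_mx 0 i).
have gQ x : g x *m Q^T = x.
  apply/rowP => i; transitivity (dot (g x) (g (delta_mx 0 i))).
    by rewrite mxE; apply: eq_bigr => j _; rewrite !mxE.
  rewrite gg /dot (bigD1 i) //= big1 ?mxE ?eqxx ?mulr1 ?addr0 // => j ji.
  by rewrite mxE (negPf ji) andbF mulr0.
have QQ : Q *m Q^T = 1%:M.
  by apply/row_matrixP => i; rewrite row_mul rowK gQ row1.
exists Q => // x.
by rewrite -[X in X *m Q]gQ -mulmxA (mulmx1C QQ) mulmx1 addrC subrK.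
Qed.

End Metric.

(** * Half-open cells and residues *)

Section Cell.
Variables (R : realType) (h : R).
Hypothesis h0 : 0 < h.

Definition cell (s : R) : int := Num.floor (s / h).

(** The inequality is strict because cells are half-open; a closed cell would
    only give the weak inequality, which does not contradict the minimality of
    the width. *)
Lemma cell_eq_lt s s' : cell s = cell s' -> `|s - s'| < h.
Proof.
rewrite /cell => e; have := floor_itv (s / h); have := floor_itv (s' / h).
rewrite e !rmorphD /= !ler_pdivlMr // !ltr_pdivrMr // => /andP[a1 a2] /andP[b1 b2].
by rewrite mulrDl mul1r in a2 b2; rewrite ltr_norml; apply/andP; split; lra.
Qed.

Lemma cell_dist_le s s' (N : nat) :
  `|s - s'| <= h * N%:R -> `|cell s - cell s'| <= N%:Z.
Proof.
have le t t' : t - t' <= h * N%:R -> cell t <= cell t' + N%:Z.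
  move=> tt'; rewrite -[N%:Z](@intrKfloor R) /cell -floorDrz ?rpred_int //.
  apply: le_floor; rewrite ler_pdivrMr // mulrDl divfK ?gt_eqF //.
  by rewrite -pmulrn mulrC -lerBlDl.
rewrite !ler_norml => /andP[ge_ss le_ss].
rewrite lerBlDl le // andbT lerBrDl lerBlDr le //; lra.
Qed.

End Cell.

Definition residue (N : nat) (z : int) : 'I_N.+1 := inord `|(z %% N.+1%:Z)%Z|.

(** Reduction modulo [N + 1] separates indices at distance at most [N]. This is
    used twice with opposite purposes: with [N] the ceiling in the number of
    colours it shows that equal colours mean equal cells, and with [N = t] it
    bounds the number of cells that a configuration meets. *)
Lemma residue_inj (N : nat) (z z' : int) :
  `|z - z'| <= N%:Z -> residue N z = residue N z' -> z = z'.
Proof.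
have bnd y : (`|(y %% N.+1%:Z)%Z|%N < N.+1)%N.
  by rewrite -ltz_nat gez0_abs ?modz_ge0 ?ltz_pmod.
move=> zN /(congr1 val); rewrite /= !inordK // => eqm.
have /eqP : (z %% N.+1%:Z)%Z = (z' %% N.+1%:Z)%Z.
  by rewrite -[LHS]gez0_abs ?modz_ge0 // eqm gez0_abs ?modz_ge0.
rewrite eqz_mod_dvd => dv; apply/eqP; rewrite -subr_eq0 -absz_eq0.
apply: contraTT zN => nz; rewrite -ltNge -abszE ltz_nat dvdn_leq //.
by rewrite lt0n.
Qed.

(** * The periodic grid colouring *)

Section Grid.
Variables (R : realType) (n k : nat) (h : R) (u : 'rV[R]_n -> 'I_k -> R).
Hypothesis h0 : 0 < h.
Hypothesis u_le : forall x y i, `|u x i - u y i| <= edist x y.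

Definition grid_residue (N : nat) (x : 'rV[R]_n) : {ffun 'I_k -> 'I_N.+1} :=
  [ffun i => residue N (cell h (u x i))].

Lemma grid_residue_cell (N : nat) x y i :
  edist x y <= h * N%:R -> grid_residue N x = grid_residue N y ->
  cell h (u x i) = cell h (u y i).
Proof.
move=> dxy /ffunP/(_ i); rewrite !ffunE; apply: residue_inj.
by apply: cell_dist_le => //; apply: le_trans dxy.
Qed.

Lemma card_grid (N : nat) : #|{ffun 'I_k -> 'I_N.+1}| = ((N + 1) ^ k)%N.
Proof. by rewrite card_ffun !card_ord addn1. Qed.

(** The hypothesis on [X] says that no copy of [X] lies within a half-open cell.
    To count the cells that a copy of [P] meets, it is enough that
    [grid_residue t] is injective on a rainbow copy: points with equal residues
    modulo [t + 1] are in one cell, hence have one colour. *)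
Lemma grid_not_arrow (X P : {fset 'rV[R]_n}) (t : nat) :
  (forall Y, congruent X Y -> exists x y i,
     [/\ x \in Y, y \in Y & h <= `|u x i - u y i|]) ->
  ((t + 1) ^ k < #|` P|)%N ->
  diam P <= h * t%:R ->
  GR_not_arrow ((absz (Num.ceil (diam X / h)) + 1) ^ k) X P.
Proof.
move=> wide cardP diamP; set N := absz _.
have Xh : diam X <= h * N%:R.
  rewrite mulrC -ler_pdivrMr // (le_trans (ceil_ge _)) // pmulrn ler_int.
  by rewrite /N abszE ler_norm.
exists (fun x => cast_ord (card_grid N) (enum_rank (grid_residue N x))).
split=> Y congY.
  move=> mono; have [x [y [i [xY yY]]]] := wide Y congY.
  rewrite leNgt => /negP; apply; apply: cell_eq_lt => //.
  apply: (@grid_residue_cell N).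
    by apply: le_trans Xh; apply: congruent_edist_le congY xY yY.
  by have /cast_ord_inj/enum_rank_inj := mono x y xY yY.
move=> rain; suff : (#|` Y| <= (t + 1) ^ k)%N.
  by rewrite (congruent_card congY) leqNgt cardP.
rewrite -card_grid; apply: (@fset_inj_card _ _ (grid_residue t)) => x y xY yY gxy.
apply/eqP; apply: contraT => /(rain x y xY yY); apply: contraNT => _.
apply/eqP; congr (cast_ord _ (enum_rank _)); apply/ffunP => i; rewrite !ffunE.
congr residue; apply: (@grid_residue_cell t) => //.
by apply: le_trans diamP; apply: congruent_edist_le congY xY yY.
Qed.

End Grid.

(** * Copies of a configuration do not fit into small cells *)

Section Widths.
Variables (R : realType) (n : nat).
Implicit Types (X Y : {fset 'rV[R]_n}).

Lemma box_width_le X Y (c : R) :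
  0 <= c -> congruent X Y -> in_box c Y -> box_width X <= c.
Proof.
move=> c0 cXY bY; apply: ge_inf; last by split=> //; exists Y.
by exists 0 => d [].
Qed.

Lemma congruent_refl X : congruent X X.
Proof.
exists id => //; apply/fsetP => x; apply/idP/imfsetP => [xX|[y /= yX ->]] //.
by exists x.
Qed.

Lemma congruent_translate X Y v :
  congruent X Y -> congruent X [fset y - v | y in Y]%fset.
Proof.
move=> [f fiso ->]; exists (fun x => f x - v).
  by move=> x y; rewrite -(fiso x y) /edist opprB addrA subrK.
apply/fsetP => z; apply/imfsetP/imfsetP => /= [[y]|[x xX ->]].
  by move=> /imfsetP[x /= xX ->] ->; exists x.
by exists (f x) => //; apply/imfsetP; exists x.
Qed.

(** In dimension 0 there is no first coordinate, so every set lies in a box of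
    width 0. *)
Lemma box_width_dim_gt0 X : 0 < box_width X -> (0 < n)%N.
Proof.
case: (posnP n) => // n0; rewrite ltNge => /negP[].
apply: (box_width_le (lexx 0) (congruent_refl X)) => y i _ _.
by move: (ltn_ord i); rewrite {2}n0.
Qed.

(** Otherwise the maximal difference of first coordinates, over the finitely
    many points of [Y], is some [c < box_width X], and translating a point of
    least first coordinate to the origin puts a copy of [X] into a box of
    width [c]. *)
Lemma box_width_le_spread X Y (i0 : 'I_n) :
  i0 = 0%N :> nat -> 0 < box_width X -> congruent X Y ->
  exists x y, [/\ x \in Y, y \in Y & box_width X <= `|x 0 i0 - y 0 i0|].
Proof.
move=> i00 a0 cXY; apply: contrapT => narrow.
have lt_a x y : x \in Y -> y \in Y -> `|x 0 i0 - y 0 i0| < box_width X.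
  by move=> xY yY; rewrite ltNge; apply/negP => w; apply: narrow; exists x, y.
suff [c [c0 ca [v bY]]] : exists c, [/\ 0 <= c, c < box_width X &
    exists v, in_box c [fset y - v | y in Y]%fset].
  have := box_width_le c0 (congruent_translate v cXY) bY.
  by rewrite leNgt ca.
(* An empty copy fits into a box of width 0. *)
have [Y0|[y yY]] := fset_0Vmem Y.
  exists 0; split=> //; exists 0 => z i /imfsetP[x /=].
  by rewrite Y0 inE.
have [y0 y0Y y0min] := fset_argmin (fun y : 'rV[R]_n => y 0 i0) yY.
exists (\big[Num.max/0]_(y <- Y) (y 0 i0 - y0 0 i0)); split.
- exact: bigmax_ge_id.
- rewrite big_seq; apply: bigmax_lt => // z zY.
  by apply: le_lt_trans (lt_a z y0 zY y0Y); apply: ler_norm.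
exists y0 => z i /imfsetP[x /= xY ->] i_0.
have -> : i = i0 by apply: val_inj; rewrite /= i_0 i00.
rewrite !mxE subr_ge0 y0min //=.
exact: (le_bigmax_seq 0 x xpredT (fun y : 'rV[R]_n => y 0 i0 - y0 0 i0)).
Qed.

Lemma min_proj_diam_le X k V p :
  \dim V = k -> orth_proj V p ->
  min_proj_diam X k <= diam [fset p x | x in X]%fset.
Proof.
move=> dV oV; apply: ge_inf; last by exists V, p.
by exists 0 => d [? [? [_ _ ->]]]; apply: diam_ge0.
Qed.

(** There is no subspace of dimension [k], and the infimum of the empty set of
    reals is 0. *)
Lemma min_proj_diam_gt_dim X k : (n < k)%N -> min_proj_diam X k = 0.
Proof.
move=> nk; rewrite /min_proj_diam.
suff -> : [set d : R | exists (V : {vspace 'rV[R]_n}) (p : 'rV[R]_n -> 'rV[R]_n),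
    [/\ \dim V = k, orth_proj V p & d = diam [fset p x | x in X]%fset]]%classic
    = set0 by exact: inf0.
rewrite -subset0 => d [V [p [dV _ _]]].
have := dimvS (subvf V); rewrite dimvf /= dV /dim /= mul1n.
by rewrite leqNgt nk.
Qed.

(** [A *m A^T = 1%:M] says that the rows of [A] are orthonormal; then
    [x *m A^T] lists the coordinates of the projection of [x] in this frame. *)
Lemma orth_frame_proj k (A : 'M[R]_(k, n)) : A *m A^T = 1%:M ->
  exists2 V : {vspace 'rV[R]_n}, \dim V = k &
    orth_proj V (fun x => x *m A^T *m A).
Proof.
move=> AA; pose L : 'Hom('rV[R]_k, 'rV[R]_n) := linfun (mulmxr A).
have LE v : L v = v *m A by rewrite lfunE.
exists (limg L).
  have L0 : lker L == 0%VS.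
    apply/lker0P => v w; rewrite !LE => /(congr1 (mulmx^~ A^T)).
    by rewrite -!mulmxA AA !mulmx1.
  have := limg_ker_dim L fullv; rewrite (eqP L0) capv0 dimv0 add0n => ->.
  by rewrite dimvf /dim /= mul1n.
move=> x; split; first by rewrite -LE memv_img ?memvf.
move=> v /memv_imgP[w _ ->]; rewrite LE dotE trmx_mul mulmxBl !mulmxA.
by rewrite -(mulmxA (x *m A^T) A A^T) AA mulmx1 subrr mxE.
Qed.

(** The coordinates in an orthonormal frame keep distances, which lets the
    diameter of a projection be computed in [k]-dimensional space. *)
Lemma edist_frame_proj k (A : 'M[R]_(k, n)) (x y : 'rV[R]_n) :
  A *m A^T = 1%:M ->
  edist (x *m A^T *m A) (y *m A^T *m A) = edist (x *m A^T) (y *m A^T).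
Proof.
move=> AA; rewrite /edist !dotE -!mulmxBl trmx_mul mulmxA.
by rewrite -(mulmxA _ A A^T) AA mulmx1.
Qed.

(** Strictness needs [0 < k]: a sum of [k] strict inequalities is strict only if
    it is not empty. *)
Lemma edist_lt_cube k (h : R) (x y : 'rV[R]_k) :
  (0 < k)%N -> (forall i, `|x 0 i - y 0 i| < h) ->
  edist x y < h * Num.sqrt k%:R.
Proof.
move=> k0 xy; have h0 : 0 < h by apply: le_lt_trans (xy (Ordinal k0)).
rewrite -[h]gtr0_norm // -sqrtr_sqr -sqrtrM ?sqr_ge0 //.
rewrite ltr_sqrt ?mulr_gt0 ?exprn_gt0 ?ltr0n //.
rewrite mulr_natr -[X in _ *+ X]card_ord -sumr_const /dot.
apply: ltr_sum => [|i _]; first by apply/hasP; exists (Ordinal k0); rewrite ?mem_index_enum.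
by rewrite !mxE -expr2 -real_normK ?num_real // ltrXn2r ?(ltW h0).
Qed.

(** Let the copy be [f @` X] with [f x = f 0 + x *m Q]. The first [k] coordinates
    of [f x - f 0] are the coordinates of [x] in the frame formed by the first
    [k] rows of [Q^T]. If all the differences of such coordinates were less than
    [h], the projection of [X] onto the span of this frame would have diameter
    less than [h * sqrt k]. *)
Lemma min_proj_diam_le_spread X Y k (h : R) (lekn : (k <= n)%N) :
  (0 < k)%N -> 0 < h -> min_proj_diam X k = h * Num.sqrt k%:R ->
  congruent X Y ->
  exists x y (i : 'I_k), [/\ x \in Y, y \in Y &
    h <= `|x 0 (widen_ord lekn i) - y 0 (widen_ord lekn i)|].
Proof.
move=> k0 h0 gE [f fiso ->]; apply: contrapT => narrow.
have [Q QQ fE] := isometry_affine fiso.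
pose J : 'M[R]_(k, n) := pid_mx k.
have JE (z : 'rV[R]_n) i : (z *m J^T) 0 i = z 0 (widen_ord lekn i).
  rewrite mxE (bigD1 (widen_ord lekn i)) //= big1 => [|j ji].
    by rewrite !mxE /= eqxx ltn_ord mulr1 addr0.
  rewrite !mxE; case: eqP => [ij|_]; last by rewrite mulr0.
  by case/negP: ji; apply/eqP/val_inj; rewrite /= ij.
have JJ : J *m J^T = 1%:M.
  by rewrite tr_pid_mx pid_mx_id // pid_mx_1.
pose A := J *m Q^T.
have AA : A *m A^T = 1%:M.
  by rewrite trmx_mul trmxK mulmxA -(mulmxA J) (mulmx1C QQ) mulmx1.
have [V dV oV] := orth_frame_proj AA.
have := min_proj_diam_le X dV oV; rewrite leNgt gE => /negP; apply.
apply: diam_lt; first by rewrite mulr_gt0 // sqrtr_gt0 ltr0n.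
move=> _ _ /imfsetP[x /= xX ->] /imfsetP[y /= yX ->].
rewrite edist_frame_proj //; apply: edist_lt_cube => // i.
have AE z : (z *m A^T) 0 i = f z 0 (widen_ord lekn i) - f 0 0 (widen_ord lekn i).
  by rewrite trmx_mul trmxK mulmxA JE fE [X in _ = X - _]mxE [RHS]addrC addKr.
rewrite !AE opprB addrA subrK ltNge; apply/negP => w; apply: narrow.
by exists (f x), (f y), i; split=> //; apply/imfsetP; [exists x|exists y].
Qed.

End Widths.

(* As 0 <= b, a, h, the ceilings below are nonnegative integers and absz is     *)
(* just the conversion from int to nat.                                         *)
Theorem theorem1p10 (R : realType) (n : nat) (X : {fset 'rV[R]_n}) :
  let b := diam X in
  (forall (P : {fset 'rV[R]_n}) (t1 : nat),
     let a := box_width X in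
     0 < a ->
     #|` P| = t1 ->
     diam P <= a * (t1%:R - 2) ->
     GR_not_arrow (absz (Num.ceil (b / a)) + 1) X P)
  /\
  (forall (m : nat) (P : {fset 'rV[R]_n}) (t2 : nat),
     has_affine_dim X m ->
     (m < n)%N ->
     let k := (n - m + 1)%N in
     let g := min_proj_diam X k in
     let h := g / Num.sqrt k%:R in
     ((t2 + 1) ^ k < #|` P|)%N ->
     diam P <= h * t2%:R ->
     GR_not_arrow ((absz (Num.ceil (b / h)) + 1) ^ k) X P).
Proof.
move=> b; split=> [P t1 a a0 cardP diamP | m P t2 _ mn k g h cardP diamP].
  have n0 : (0 < n)%N := box_width_dim_gt0 a0.
  have t12 : (2 <= t1)%N.
    have := le_trans (diam_ge0 P) diamP.
    by rewrite pmulr_rge0 // subr_ge0 ler_nat.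
  rewrite -[X in GR_not_arrow X]expn1.
  pose u (x : 'rV[R]_n) (_ : 'I_1) := x 0 (Ordinal n0).
  apply: (@grid_not_arrow _ _ _ _ u _ _ _ _ (t1 - 2)) => //.
  - by move=> x y i; apply: coord_le_edist.
  - move=> Y cXY.
    have [x [y [xY yY w]]] := @box_width_le_spread _ _ _ _ (Ordinal n0) erefl a0 cXY.
    by exists x, y, ord0.
  - by rewrite cardP expn1 addn1 subn2 -ltnS; case: t1 t12 {cardP diamP} => [|[]].
  by rewrite natrB.
have k0 : (0 < k)%N by rewrite /k addn1.
have sk0 : 0 < Num.sqrt k%:R :> R by rewrite sqrtr_gt0 ltr0n.
(* If [h <= 0], then [P] has diameter 0 but at least two points. *)
have h0 : 0 < h.
  rewrite ltNge; apply/negP => h0.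
  have P0 : diam P <= 0 by apply: le_trans diamP _; rewrite mulr_le0_ge0.
  suff : (#|` P| <= 1)%N.
    by rewrite leqNgt (leq_ltn_trans _ cardP) // expn_gt0 addn1.
  exact: diam_le0_card.
have gE : min_proj_diam X k = h * Num.sqrt k%:R by rewrite /h divfK ?gt_eqF.
(* The only failure, [k = n + 1], would make [g] an infimum over no subspace. *)
have lekn : (k <= n)%N.
  rewrite leqNgt; apply/negP => /(min_proj_diam_gt_dim X) g0.
  by move: h0; rewrite /h /g g0 mul0r ltxx.
pose u (x : 'rV[R]_n) i := x 0 (widen_ord lekn i).
apply: (@grid_not_arrow _ _ _ _ u _ _ _ _ t2) => //.
  by move=> x y i; apply: coord_le_edist.
by move=> Y cXY; exact: (min_proj_diam_le_spread lekn k0 h0 gE cXY).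
Qed.
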